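(* Let $p_0,p_1,\sigma$ be positive real scalars and let $\epsilon>0$. Consider the scalar optimization problem $$\min_{p_t,a_t}\left\{\int_0^1\left(\frac{1+\epsilon}{2}a_t^2+\frac{1-\epsilon}{2}a_t^2\right)dt\;\middle|\;\dot p_t=2a_tp_t+\sigma^2\text{ on }[0,1],\ p_t|_{t=0}=p_0,\ p_t|_{t=1}=p_1\right\}.$$ (i) If $|p_1-p_0|>\sigma^2$, then there exists a unique solution to this problem, and its covariance path has the form $$p_t=\alpha e^{bt}-\frac{\sigma^4}{4\alpha b^2}e^{-bt}$$ for some nonzero real constants $\alpha,b$. (ii) If $|p_1-p_0|<\sigma^2$, then there exists a unique solution to this problem, and its covariance path has the form $$p_t=\frac{\sigma^2}{\omega}\cos(\omega t+\theta)$$ for some constants $0<\omega<\pi$ and $-\tfrac{\pi}{2}<\theta<\tfrac{\pi}{2}$.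
   Context: The problem is the scalar ($n=1$) case of minimizing $\int_0^1\left(\frac{1+\epsilon}{2}\operatorname{tr}(A_tA_t')+\frac{1-\epsilon}{2}\operatorname{tr}(A_tA_t)\right)dt$ subject to $\dot P_t=A_tP_t+P_tA_t'+\sigma^2 I$ with the endpoints $P_0,P_1$ specified. The minimization is over pairs of real-valued functions $(p_t,a_t)$ on $[0,1]$ with $p_t>0$ for all $t\in[0,1]$. *)

(* Defs.v *)
From HB Require Import structures.
From mathcomp Require Import all_boot all_order all_algebra.
From mathcomp Require Import all_classical all_reals all_analysis.
Set Implicit Arguments.
Unset Strict Implicit.
Unset Printing Implicit Defensive.
Import Order.TTheory GRing.Theory Num.Theory.
Import numFieldNormedType.Exports.
Local Open Scope classical_set_scope.
Local Open Scope ring_scope.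

(* Absolute continuity on [0, 1], as "p is the indefinite Lebesgue integral of
   an integrable function"; the density v is then the a.e. derivative of p. *)
Definition absolutely_continuous01 (R : realType) (p : R -> R) : Prop :=
  exists v : R -> R,
    (@lebesgue_measure R).-integrable `[0, 1] (EFin \o v) /\
    forall t : R, t \in `[0, 1] ->
      p t = p 0 + \int[@lebesgue_measure R]_(s in `[0, t]) v s.

(* A path is a function on R of which only the values on [0, 1] matter.  The
   controls are arbitrary measurable functions, so p is only absolutely
   continuous and satisfies the differential equation almost everywhere; every
   pair with a continuous control satisfying it everywhere is included. *)
Definition feasible (R : realType) (p0 p1 sigma : R) (p a : R -> R) : Prop :=
  [/\ measurable_fun (`[0, 1] : set R) a,
      absolutely_continuous01 p,
      forall t : R, t \in `[0, 1] -> 0 < p t,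
      {ae @lebesgue_measure R, forall t : R, t \in `[0, 1] ->
        is_derive t 1 p (2 * a t * p t + sigma ^+ 2)} &
      p 0 = p0 /\ p 1 = p1].

(* The integrand equals a_t^2 >= 0, so the integral always makes sense in
   [0, +oo]; pairs of infinite cost are allowed as competitors. *)
Definition cost (R : realType) (eps : R) (a : R -> R) : \bar R :=
  (\int[@lebesgue_measure R]_(t in `[0%R, 1%R])
     ((1 + eps) / 2 * a t ^+ 2 + (1 - eps) / 2 * a t ^+ 2)%R%:E)%E.

Definition is_solution (R : realType) (p0 p1 sigma eps : R) (p a : R -> R) :
    Prop :=
  feasible p0 p1 sigma p a /\
  forall q c : R -> R, feasible p0 p1 sigma q c ->
    (cost eps a <= cost eps c)%E.

(* Two pairs are identified when the paths agree on [0, 1] and the controls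
   agree almost everywhere there. *)
Definition is_unique_solution (R : realType) (p0 p1 sigma eps : R)
    (p a : R -> R) : Prop :=
  is_solution p0 p1 sigma eps p a /\
  forall q c : R -> R, is_solution p0 p1 sigma eps q c ->
    (forall t : R, t \in `[0, 1] -> q t = p t) /\
    {ae @lebesgue_measure R, forall t : R, t \in `[0, 1] -> c t = a t}.

(* Main.v *)
(* In the coordinate x = ln p the running cost is
     4 a^2 = x'^2 + sigma^4 e^(-2x) - 2 sigma^2 x' e^(-x),
   and the last term integrates to boundary values, so the problem is strictly
   convex in x: every positive solution of p'' = E p, p'^2 = sigma^4 + E p^2
   with the right endpoints is the unique minimizer.  Such p are hyperbolic for
   E = b^2 and trigonometric for E = -omega^2, and their parameters are found
   from the endpoints by the intermediate value theorem.
   Competitors are only absolutely continuous, hence the chain and product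
   rules for indefinite Lebesgue integrals. *)
Require Import Defs.
From HB Require Import structures.
From mathcomp Require Import all_boot all_order all_algebra.
From mathcomp Require Import all_classical all_reals all_analysis.
From mathcomp Require Import measurable_realfun ring lra.
Set Implicit Arguments.
Unset Strict Implicit.
Import Order.TTheory GRing.Theory Num.Theory.
Import numFieldNormedType.Exports.
Local Open Scope classical_set_scope.
Local Open Scope ring_scope.

(** * Uniform continuity on a segment *)

Lemma unif_continuous_segment {R : realType} {f : R -> R} {a b : R} :
  {within `[a, b], continuous f} -> forall {e : R}, 0 < e ->
  exists2 d : R, 0 < d & forall s t, s \in `[a, b] -> t \in `[a, b] ->
    `|s - t| < d -> `|f s - f t| < e.
Proof.
move=> cf e e0.
have /compact_near_coveringP/near_covering_withinP cov := @segment_compact R a b.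
pose P (d x : R) := forall y, y \in `[a, b] -> `|x - y| < d -> `|f x - f y| < e.
have : \forall d \near 0^'+, `[a, b] `<=` P d.
  apply: cov => x /= xab.
  have /subspace_continuousP/(_ x xab)/cvgrPdist_lt/(_ (e / 2)) := cf.
  rewrite divr_gt0// => /(_ isT)/nbhs_ballP[r /= r0 Hr].
  (* A point within [r / 2] of [x], and any point within [d < r / 2] of that one, both lie in the
     ball of radius [r] where [f] is [e / 2]-close to [f x]. Compactness then makes one [d] serve
     every [x]. *)
  exists (ball x (r / 2), [set d | 0 < d /\ d < r / 2]) => /=.
    split; first by apply: nbhsx_ballx; rewrite divr_gt0.
    have : \forall d \near (0 : R)^'+, 0 < d /\ d < r / 2.
      near=> d; split; near: d; first exact: nbhs_right_gt.
      by apply: nbhs_right_lt; rewrite divr_gt0.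
    by [].
  move=> -[x' d] /= [xx' [d0 dr]] x'ab y yab x'y.
  have Hx' : `|f x - f x'| < e / 2.
    apply: Hr => //; apply: lt_le_trans xx' _.
    by rewrite ler_pdivrMr// ler_peMr ?ler1n// ltW.
  have Hy : `|f x - f y| < e / 2.
    apply: Hr => //; rewrite /ball/=.
    rewrite (_ : x - y = (x - x') + (x' - y)); last ring.
    rewrite (le_lt_trans (ler_normD _ _))// [ltRHS]splitr ltrD//.
    exact: lt_trans dr.
  rewrite (_ : f x' - f y = - (f x - f x') + (f x - f y)); last ring.
  by rewrite (le_lt_trans (ler_normD _ _))// [ltRHS]splitr ltrD// normrN.
move=> nearP; have : \forall d \near (0 : R)^'+, 0 < d /\ `[a, b] `<=` P d.
  by near=> d; split; near: d => //; exact: nbhs_right_gt.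
move=> /filter_ex[d [d0 Pd]]; exists d => // s t sab tab; exact: Pd.
Unshelve. all: by end_near. Qed.

(** * Calculus of indefinite Lebesgue integrals on [0, 1] *)

Section absolute_continuity.
Context (R : realType).
Notation mu := (@lebesgue_measure R).

(** This is [absolutely_continuous01] with the density exposed, so that the rules below can compute
    densities. *)
Definition primitive01 (f v : R -> R) : Prop :=
  mu.-integrable `[0, 1] (EFin \o v) /\
  forall t : R, t \in `[0, 1] -> f t = f 0 + \int[mu]_(s in `[0, t]) v s.

Lemma integrable01S (v : R -> R) (A : set R) : measurable A ->
  A `<=` `[0, 1] -> mu.-integrable `[0, 1] (EFin \o v) ->
  mu.-integrable A (EFin \o v).
Proof. by move=> mA A01; apply: integrableS. Qed.

Lemma integrable01_itv (v : R -> R) (s t : R) (b c : bool) : 0 <= s -> t <= 1 ->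
  mu.-integrable `[0, 1] (EFin \o v) ->
  mu.-integrable [set` Interval (BSide b s) (BSide c t)] (EFin \o v).
Proof.
move=> s0 t1; apply: integrable01S => // x /=.
by rewrite !in_itv/= => /andP[]; case: b; case: c => /= h1 h2; apply/andP; split;
  lra.
Qed.

Lemma primitive01_incr {f v : R -> R} {s t : R} : primitive01 f v ->
  0 <= s -> s <= t -> t <= 1 -> f t - f s = \int[mu]_(r in `]s, t]) v r.
Proof.
move=> [iv fv] s0 st t1.
rewrite (fv t) ?in_itv/= ?(le_trans s0)//.
rewrite [f s]fv ?in_itv/= ?s0 ?(le_trans st)//.
rewrite -(@Rintegral_itvB _ v (BLeft 0) (BRight t) s) ?bnd_simp//; first ring.
exact: integrable01_itv.
Qed.

(* The increments telescope over the uniform partition of [0, x]. *)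
Lemma eq0_of_small_increments (G N : R -> R) :
  (forall e : R, 0 < e -> exists2 d : R, 0 < d &
    forall s t, 0 <= s -> s <= t -> t <= 1 -> t - s < d ->
      `|G t - G s| <= e * (N t - N s)) ->
  forall x, x \in `[0, 1] -> G x = G 0.
Proof.
move=> H x; rewrite in_itv/= => /andP[x0 x1].
have K e : 0 < e -> `|G x - G 0| <= e * (N x - N 0).
  move=> e0; have [d d0 Hd] := H e e0.
  pose n := (Num.trunc d^-1).+1.
  have n0 : 0 < n%:R :> R by rewrite ltr0n.
  have nd : n%:R^-1 < d.
    rewrite invf_plt ?posrE//; exact: truncnS_gt.
  pose u k := x * k%:R / n%:R.
  have ux : u n = x by rewrite /u -mulrA divff ?mulr1// gt_eqF.
  have u0 : u 0%N = 0 by rewrite /u mulr0 mul0r.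
  rewrite -ux -u0 -(telescope_sumr (G \o u))// -(telescope_sumr (N \o u))//.
  rewrite mulr_sumr; apply: le_trans (ler_norm_sum _ _ _) _.
  rewrite !big_mkord; apply: ler_sum => i _ /=.
  have uS : u i.+1 - u i = x / n%:R by rewrite /u -natr1; ring.
  have xn : x / n%:R <= n%:R^-1 by rewrite -{2}[_^-1]mul1r ler_wpM2r ?invr_ge0// ltW.
  have xn0 : 0 <= x / n%:R by rewrite divr_ge0// ltW.
  apply: Hd; rewrite ?uS.
  - by rewrite /u divr_ge0 ?mulr_ge0// ltW.
  - by rewrite -subr_ge0 uS.
  - rewrite /u ler_pdivrMr// mul1r; apply: (@le_trans _ _ (1 * i.+1%:R)).
      by rewrite ler_wpM2r.
    by rewrite mul1r ler_nat.
  - exact: le_lt_trans nd.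
apply/eqP; rewrite -subr_eq0 -normr_le0; apply/ler_addgt0Pr => e e0.
rewrite add0r; set A := N x - N 0 in K.
have A1 : 0 < `|A| + 1 by rewrite ltr_wpDl.
apply: (le_trans (K (e / (`|A| + 1)) _)); first by rewrite divr_gt0.
rewrite mulrAC ler_pdivrMr// ler_wpM2l// ?(ltW e0)//.
by rewrite (le_trans (ler_norm _))// lerDl.
Qed.

(** On short intervals [f] minus the integral of [h] has increments at most [e] times those of the
    integral of [m], so [eq0_of_small_increments] makes it constant. The chain and product rules
    both reduce to this: [k] arises from [h] by freezing the continuous factors on the interval. *)
Lemma primitive01_local (f h m : R -> R) :
  mu.-integrable `[0, 1] (EFin \o h) -> mu.-integrable `[0, 1] (EFin \o m) ->
  (forall e : R, 0 < e -> exists2 d : R, 0 < d &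
    forall s t, 0 <= s -> s <= t -> t <= 1 -> t - s < d ->
    exists k : R -> R, [/\ mu.-integrable `[0, 1] (EFin \o k),
      f t - f s = \int[mu]_(r in `]s, t]) k r &
      forall r, r \in `]s, t] -> `|k r - h r| <= e * m r]) ->
  primitive01 f h.
Proof.
move=> ih im H; split=> // x x01.
have P (v : R -> R) : mu.-integrable `[0, 1] (EFin \o v) ->
    primitive01 (fun t => \int[mu]_(s in `[0, t]) v s) v.
  by move=> iv; split => // t _; rewrite set_itv1 Rintegral_set1 add0r.
have ph := P _ ih; have pm := P _ im.
pose G t := f t - \int[mu]_(s in `[0, t]) h s.
have : G x = G 0.
  apply: (@eq0_of_small_increments _ (fun t => \int[mu]_(s in `[0, t]) m s)) => // e e0.
  have [d d0 Hd] := H e e0; exists d => // s t s0 st t1 std.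
  have [k [ik fk kh]] := Hd s t s0 st t1 std.
  have -> : G t - G s = \int[mu]_(r in `]s, t]) (k r - h r).
    rewrite RintegralB//; try exact: integrable01_itv.
    rewrite -fk -(primitive01_incr ph)// /G; ring.
  rewrite (primitive01_incr pm)//.
  have ikh : mu.-integrable `[0, 1] (EFin \o (fun r => k r - h r)).
    exact: (@integrableB _ _ _ mu _ _ (EFin \o k) (EFin \o h)).
  apply: le_trans (le_normr_Rintegral _ _) _ => //; first exact: integrable01_itv.
  rewrite -RintegralZl//; last exact: integrable01_itv.
  apply: le_Rintegral => //.
  - by apply: integrable01_itv => //; exact: integrable_norm.
  - apply: integrable01_itv => //.
    exact: (@integrableZl _ _ _ mu _ _ e (EFin \o m)).
rewrite /G set_itv1 Rintegral_set1 subr0 => <-; ring.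
Qed.

Lemma primitive01_continuous {f v : R -> R} :
  primitive01 f v -> {within `[0, 1], continuous f}.
Proof.
move=> [iv fv].
have := parameterized_integral_continuous ler01 iv.
rewrite /parameterized_integral => c.
pose g t := f 0 + \int[mu]_(s in `[0, t]) v s.
have gf : {in `[0, 1]%classic, g =1 f} by move=> t /[!inE] t01; rewrite [RHS]fv.
apply: (@subspace_eq_continuous _ _ _ (g : subspace `[0, 1] -> R)) => //.
by move=> x; apply: cvgD; [exact: cvg_cst|exact: c].
Qed.

Lemma bounded_within_segment (g : R -> R) :
  {within `[0, 1], continuous g} -> [bounded g x | x in `[0, 1]].
Proof.
move=> cg; have := continuous_compact cg (@segment_compact R 0 1).
move=> /compact_bounded[M [Mr HM]]; exists M; split => // y My x x01.
by apply: (HM y My); exists x.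
Qed.

Lemma integrable_continuousM (g v : R -> R) : {within `[0, 1], continuous g} ->
  mu.-integrable `[0, 1] (EFin \o v) ->
  mu.-integrable `[0, 1] (EFin \o (fun t => g t * v t)).
Proof.
move=> cg iv; apply: (@integrableMr _ _ _ mu _ _ g (EFin \o v)) => //.
  exact: subspace_continuous_measurable_fun.
exact: bounded_within_segment.
Qed.

Lemma itv01P {s t r : R} : 0 <= s -> t <= 1 -> r \in `]s, t] ->
  r \in `[0, 1] /\ s < r <= t.
Proof.
move=> s0 t1; rewrite !in_itv/= => /andP[sr rt]; split; last by rewrite sr.
by rewrite (le_trans s0 (ltW sr)) (le_trans rt).
Qed.

Lemma primitive01_comp (q v F dF : R -> R) : primitive01 q v ->
  (forall t : R, t \in `[0, 1] -> is_derive (q t) 1 F (dF (q t))) ->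
  {within `[0, 1], continuous (dF \o q)} ->
  primitive01 (F \o q) (fun t => dF (q t) * v t).
Proof.
move=> qv HF cdF; have iv := qv.1; have cq := primitive01_continuous qv.
apply: (@primitive01_local _ _ (fun t => `|v t|)).
- exact: integrable_continuousM.
- exact: integrable_norm.
move=> e e0; have [d d0 Hd] := unif_continuous_segment cdF e0.
exists d => // s t s0 st t1 std.
have st01 r : r \in `[s, t] -> r \in `[0, 1].
  by rewrite !in_itv/= => /andP[sr rt]; rewrite (le_trans s0 sr) (le_trans rt t1).
have cqst : {within `[s, t], continuous q}.
  by apply: continuous_subspaceW cq => r /= /st01.
have [xi xist Hxi] : exists2 xi, xi \in `[s, t] &
    F (q t) - F (q s) = dF (q xi) * (q t - q s).
  have mid y : Num.min (q s) (q t) <= y <= Num.max (q s) (q t) ->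
      exists2 r, r \in `[s, t] & q r = y by exact: (@IVT R q s t y st cqst).
  have mvt y z : y <= z -> Num.min (q s) (q t) <= y -> z <= Num.max (q s) (q t) ->
      exists2 r, r \in `[s, t] & F z - F y = dF (q r) * (z - y).
    move=> yz my zM.
    have D x : x \in `[y, z] -> is_derive x 1 F (dF x).
      rewrite in_itv/= => /andP[yx xz].
      have [|r rst <-] := mid x; first by rewrite (le_trans my yx) (le_trans xz zM).
      by apply: HF; exact: st01.
    have Do x : x \in `]y, z[ -> is_derive x 1 F (dF x).
      by move=> xyz; apply: D; exact: subset_itv_oo_cc.
    have cF : {within `[y, z], continuous F}.
      by apply: derivable_within_continuous => x /D[].
    have [x + ->] := MVT_segment yz Do cF.
      rewrite in_itv/= => /andP[yx xz].
      have [|r rst <-] := mid x; first by rewrite (le_trans my yx) (le_trans xz zM).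
      by exists r.
  (* [q] need not be monotone, so the mean value theorem is applied from the smaller to the larger
     of the two values. *)
  have [qst|qts] := leP (q s) (q t).
    by apply: mvt => //; rewrite ?ge_min ?le_max ?lexx ?orbT.
  have [||r rst Hr] := mvt _ _ (ltW qts); rewrite ?ge_min ?le_max ?lexx ?orbT//.
  by exists r => //; rewrite -opprB Hr -mulrN opprB.
exists (fun r => dF (q xi) * v r); split.
- exact: (@integrableZl _ _ _ mu _ _ (dF (q xi)) (EFin \o v)).
- rewrite /= Hxi (primitive01_incr qv)// RintegralZl//; exact: integrable01_itv.
- move=> r /(itv01P s0 t1)[r01 /andP[sr rt]].
  rewrite -mulrBl normrM ler_wpM2r// ltW//; apply: Hd => //; first exact: st01.
  move: xist; rewrite in_itv/= => /andP[sx xt].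
  apply: le_lt_trans std; rewrite ler_norml; apply/andP; split; lra.
Qed.

Lemma primitive01M (f g v w : R -> R) : primitive01 f v -> primitive01 g w ->
  primitive01 (f \* g) (fun t => f t * w t + g t * v t).
Proof.
move=> fv gw; have cf := primitive01_continuous fv.
have cg := primitive01_continuous gw; have iv := fv.1; have iw := gw.1.
apply: (@primitive01_local _ _ (fun t => `|w t| + `|v t|)).
- apply: (@integrableD _ _ _ mu _ _ (EFin \o (fun t => f t * w t))
    (EFin \o (fun t => g t * v t))) => //; exact: integrable_continuousM.
- apply: (@integrableD _ _ _ mu _ _ (EFin \o (fun t => `|w t|))
    (EFin \o (fun t => `|v t|))) => //; exact: integrable_norm.
move=> e e0; have [d1 d10 H1] := unif_continuous_segment cf e0.
have [d2 d20 H2] := unif_continuous_segment cg e0.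
exists (Num.min d1 d2); first by rewrite lt_min d10.
move=> s t s0 st t1; rewrite lt_min => /andP[std1 std2].
have iZ k u : mu.-integrable `[0, 1] (EFin \o u) ->
    mu.-integrable `[0, 1] (EFin \o (fun r => k * u r)).
  exact: (@integrableZl _ _ _ mu _ _ k (EFin \o u)).
(* Freezing [f] at the right end and [g] at the left end makes the increment exact: [f t * g t - f s
   * g s = f t * (g t - g s) + g s * (f t - f s)]. *)
exists (fun r => f t * w r + g s * v r); split.
- by apply: (@integrableD _ _ _ mu _ _ (EFin \o (fun r => f t * w r))
    (EFin \o (fun r => g s * v r))) => //; exact: iZ.
- rewrite RintegralD//; last 2 first.
  + by apply: integrable01_itv => //; exact: iZ.
  + by apply: integrable01_itv => //; exact: iZ.
  rewrite !RintegralZl//; try exact: integrable01_itv.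
  rewrite -(primitive01_incr fv)// -(primitive01_incr gw)//=; ring.
- move=> r /(itv01P s0 t1)[r01 /andP[sr rt]].
  have t01 : t \in `[0, 1] by rewrite in_itv/= (le_trans s0 st).
  have s01 : s \in `[0, 1] by rewrite in_itv/= s0 (le_trans st).
  rewrite (_ : _ - _ = (f t - f r) * w r + (g s - g r) * v r); last ring.
  rewrite (le_trans (ler_normD _ _))// !normrM mulrDr lerD// ler_wpM2r// ltW//.
    apply: H1 => //; apply: le_lt_trans std1.
    rewrite ler_norml; apply/andP; split; lra.
  apply: H2 => //; apply: le_lt_trans std2.
  rewrite ler_norml; apply/andP; split; lra.
Qed.

Lemma primitive01D (f g v w : R -> R) : primitive01 f v -> primitive01 g w ->
  primitive01 (f \+ g) (fun t => v t + w t).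
Proof.
move=> [iv fv] [iw gw]; split.
  exact: (@integrableD _ _ _ mu _ _ (EFin \o v) (EFin \o w)).
move=> t t01 /=; have /andP[t0 t1] : 0 <= t <= 1 by rewrite in_itv in t01.
rewrite fv// gw// RintegralD//; try exact: integrable01_itv.
ring.
Qed.

Lemma primitive01Z (k : R) (f v : R -> R) : primitive01 f v ->
  primitive01 (fun t => k * f t) (fun t => k * v t).
Proof.
move=> [iv fv]; split.
  exact: (@integrableZl _ _ _ mu _ _ k (EFin \o v)).
move=> t t01 /=; have /andP[t0 t1] : 0 <= t <= 1 by rewrite in_itv in t01.
by rewrite fv// RintegralZl//; [rewrite mulrDr|exact: integrable01_itv].
Qed.

Lemma primitive01_id : primitive01 id (fun=> 1).
Proof.
split.
  apply: continuous_compact_integrable; first exact: segment_compact.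
  by apply: continuous_subspaceT => x; exact: cvg_cst.
move=> t; rewrite in_itv/= => /andP[t0 _].
rewrite Rintegral_cst//= lebesgue_measure_itv/= lte_fin.
case: ltgtP t0 => //= [t0 _|<- _].
  by rewrite subr0 mul1r add0r.
by rewrite mulr0 add0r.
Qed.

Lemma primitive01_derive (f df : R -> R) :
  (forall t : R, is_derive t 1 f (df t)) -> continuous df -> primitive01 f df.
Proof.
move=> Hf cdf; have := @primitive01_comp id (fun=> 1) f df primitive01_id.
under [X in _ -> _ -> primitive01 _ X]eq_fun do rewrite mulr1.
by apply=> //; apply: continuous_subspaceT => x; exact: cdf.
Qed.

(** Lebesgue differentiation, applied to [v] extended by zero to the whole line. Outside [0, 1]
    nothing is known of [f], so the two-sided derivative is only identified in the open interval;
    the endpoints are discarded as null sets. *)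
Lemma primitive01_ae_derive (f v : R -> R) : primitive01 f v ->
  {ae mu, forall t : R, t \in `[0, 1] -> is_derive t 1 f (v t)}.
Proof.
move=> [iv fv]; pose V := v \_ (`[0, 1] : set R).
have iV : mu.-integrable setT (EFin \o V).
  by rewrite /V -restrict_EFin; apply/(integrable_mkcond _ _).1.
have lV : locally_integrable [set: R] V by exact: integrable_locally.
have iVy (y : R) : mu.-integrable [set` Interval (BLeft 0) (BRight y)] (EFin \o V).
  exact: integrableS iV.
have H := FTC1 iVy lV.
have n0 (a : R) : {ae mu, forall t : R, t != a}.
  exists [set a]; split => //; first exact: lebesgue_measure_set1.
  by move=> x /= /negP; rewrite negbK => /eqP.
have aeF := ae_filter_ringOfSetsType mu.
move: H (n0 0) (n0 1); apply: filterS3 => t Ht t0 t1 t01.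
have t01o : t \in `]0, 1[.
  by move: t01; rewrite !in_itv/= !lt_neqAle => /andP[-> ->]; rewrite eq_sym t0 t1.
have [dV VE] : derivable (fun x : R => \int[mu]_(s in `[0, x]) V s) t 1 /\
    derive1 (fun x : R => \int[mu]_(s in `[0, x]) V s) t = V t.
  by apply: Ht; rewrite /= lte_fin; move: t01o; rewrite in_itv/= => /andP[].
have vt : v t = V t by rewrite /V patchE mem_set.
rewrite vt; apply: (@near_eq_is_derive R R^o R^o
    (fun y => f 0 + \int[mu]_(s in `[0, y]) V s) f t 1 (V t)).
  apply: filterS (near_in_itvoo t01o) => y y01.
  rewrite [RHS]fv; last exact: subset_itv_oo_cc y01.
  congr (_ + _); apply: eq_Rintegral => x; rewrite inE/= => xy.
  rewrite /V patchE mem_set//=.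
  move: xy y01; rewrite !in_itv/= => /andP[-> xy] /andP[_ y1].
  by rewrite (le_trans xy)// ltW.
rewrite -[V t]add0r -VE derive1E; apply: is_deriveD; exact: derivableP.
Qed.

End absolute_continuity.

(** * Optimality of extremals by calibration *)

Section verification.
Context (R : realType).
Notation mu := (@lebesgue_measure R).

Lemma primitive01V (q v : R -> R) : primitive01 q v ->
  (forall t : R, t \in `[0, 1] -> q t != 0) ->
  primitive01 (fun t => (q t)^-1) (fun t => - (q t) ^- 2 * v t).
Proof.
move=> qv q0; have cq := primitive01_continuous qv.
apply: (@primitive01_comp R q v GRing.inv (fun y => - y ^- 2)) => //.
  move=> t t01; have := is_deriveV (q0 t t01) (is_derive_id (q t) (1 : R)).
  by rewrite /GRing.scale/= mulr1.
apply/subspace_continuousP => t t01.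
apply: (@cvgN R R^o); apply: (@cvgV R R).
  by rewrite expf_neq0// q0.
rewrite expr2; apply: (@cvgM R R); exact: ((iffLR (subspace_continuousP _ _) cq) t t01).
Qed.

Lemma primitive01_ln (q v : R -> R) : primitive01 q v ->
  (forall t : R, t \in `[0, 1] -> 0 < q t) ->
  primitive01 (fun t => ln (q t)) (fun t => (q t)^-1 * v t).
Proof.
move=> qv q0; have cq := primitive01_continuous qv.
apply: (@primitive01_comp R q v (@ln R) GRing.inv) => //.
  by move=> t t01; exact/is_derive1_ln/q0.
apply/subspace_continuousP => t t01.
apply: (@cvgV R R); first by rewrite gt_eqF// q0.
exact: ((iffLR (subspace_continuousP _ _) cq) t t01).
Qed.

Lemma costE (eps : R) (a : R -> R) :
  cost eps a = (\int[mu]_(t in `[0%R, 1%R]) (a t ^+ 2)%:E)%E.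
Proof. by apply: eq_integral => t _; congr EFin; field. Qed.

(** Almost everywhere the derivative of [q] is given both by its density and by the differential
    equation. Hence the path determines the control up to a null set. *)
Lemma feasible_density (p0 p1 sigma : R) (q c : R -> R) :
  feasible p0 p1 sigma q c -> exists2 v, primitive01 q v &
    {ae mu, forall t : R, t \in `[0, 1] -> c t = (v t - sigma ^+ 2) / (2 * q t)}.
Proof.
move=> [mc [v qv] qpos dq _]; exists v => //.
have aeF := ae_filter_ringOfSetsType mu.
move: dq (primitive01_ae_derive qv); apply: filterS2 => t dq dv t01.
have qt0 : q t != 0 by rewrite gt_eqF// qpos.
have -> : v t = 2 * c t * q t + sigma ^+ 2.
  have H1 := dq t01; have H2 := dv t01.
  by rewrite -(@derive_val _ _ _ _ _ _ _ H1) -(@derive_val _ _ _ _ _ _ _ H2).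
by field.
Qed.

(** With [X = ln x] and [Y = ln y], this says that the graph of the convex function [e^(-2X)] lies
    above its tangent at [X]. *)
Lemma convexity_gap_ge0 (x y : R) : 0 < x -> 0 < y ->
  0 <= y ^- 2 - x ^- 2 + 2 * (ln y - ln x) / x ^+ 2.
Proof.
move=> x0 y0; have := expR_ge1Dx ((ln x - ln y) + (ln x - ln y)).
rewrite !expRD expRN !lnK ?posrE// => H.
have -> : y ^- 2 - x ^- 2 + 2 * (ln y - ln x) / x ^+ 2 =
    x ^- 2 * (x / y * (x / y) - (1 + (ln x - ln y + (ln x - ln y)))).
  by field; rewrite !gt_eqF.
by rewrite mulr_ge0 ?subr_ge0// invr_ge0 sqr_ge0.
Qed.

Section extremal.
Context (p0 p1 sigma eps E : R) (p dp : R -> R).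
Hypothesis p_derive : forall t : R, is_derive t 1 p (dp t).
Hypothesis dp_derive : forall t : R, is_derive t 1 dp (E * p t).
Hypothesis energy : forall t : R, dp t ^+ 2 = sigma ^+ 4 + E * p t ^+ 2.
Hypothesis p_gt0 : forall t : R, t \in `[0, 1] -> 0 < p t.
Hypotheses (p_0 : p 0 = p0) (p_1 : p 1 = p1).

Let a t := (dp t - sigma ^+ 2) / (2 * p t).

Let continuous_of_derive (f df : R -> R) :
  (forall t : R, is_derive t 1 f (df t)) -> continuous f.
Proof.
by move=> fdf t; apply/differentiable_continuous/derivable1_diffP; have [] := fdf t.
Qed.

Let prim_p : primitive01 p dp.
Proof. exact: primitive01_derive p_derive (continuous_of_derive dp_derive). Qed.

Let prim_dp : primitive01 dp (fun t => E * p t).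
Proof.
apply: primitive01_derive dp_derive _ => t.
by apply: cvgM; [exact: cvg_cst|exact: (continuous_of_derive p_derive)].
Qed.

Let prim_pV : primitive01 (fun t => (p t)^-1) (fun t => - (p t) ^- 2 * dp t).
Proof. by apply: primitive01V => // t t01; rewrite gt_eqF// p_gt0. Qed.

(** The logarithmic derivative [dp / p] of the extremal, as a primitive. *)
Let prim_u := primitive01M prim_dp prim_pV.

Let a_continuous : {within `[0, 1], continuous a}.
Proof.
(* [a] is half of [dp / p] minus [sigma^2 / 2] times [1 / p], a combination of primitives. *)
have := primitive01_continuous
  (primitive01D (primitive01Z 2^-1 prim_u) (primitive01Z (- (sigma ^+ 2 / 2)) prim_pV)).
rewrite (_ : _ \+ _ = a)//; apply/funext => t /=.
by rewrite /a invfM; set y := (p t)^-1; field.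
Qed.

Lemma extremal_feasible : feasible p0 p1 sigma p a.
Proof.
split => //.
- exact: subspace_continuous_measurable_fun.
- by exists dp.
- apply: aeW => t t01.
  rewrite (_ : 2 * a t * p t + sigma ^+ 2 = dp t)//.
  by rewrite /a; field; rewrite gt_eqF// p_gt0.
Qed.

(* [h] is the density of [2 (dp / p) z + 2 sigma^2 (1 / q - 1 / p)] with
   [z = ln q - ln p], which vanishes at 0 and 1. *)
Lemma calibration (q v : R -> R) : primitive01 q v ->
  (forall t : R, t \in `[0, 1] -> 0 < q t) -> q 0 = p0 -> q 1 = p1 ->
  exists h : R -> R, [/\ mu.-integrable `[0, 1] (EFin \o h),
    \int[mu]_(t in `[0, 1]) h t = 0 &
    forall t : R, t \in `[0, 1] ->
      4 * ((v t - sigma ^+ 2) / (2 * q t)) ^+ 2 - 4 * a t ^+ 2 - h t =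
      (v t / q t - dp t / p t) ^+ 2 +
      sigma ^+ 4 * (q t ^- 2 - p t ^- 2 + 2 * (ln (q t) - ln (p t)) / p t ^+ 2)].
Proof.
move=> qv qpos q0 q1.
have prim_qV := primitive01V qv (fun t t01 => lt0r_neq0 (qpos t t01)).
have prim_z := primitive01D (primitive01_ln qv qpos)
  (primitive01Z (-1) (primitive01_ln prim_p p_gt0)).
have P := primitive01D (primitive01Z 2 (primitive01M prim_u prim_z))
  (primitive01Z (2 * sigma ^+ 2) (primitive01D prim_qV (primitive01Z (-1) prim_pV))).
eexists; split; first exact: P.1.
  have := P.2 1; rewrite in_itv/= ler01 lexx => /(_ isT).
  rewrite p_0 p_1 q0 q1 !mulN1r !subrr !mulr0 !addr0 add0r => <-.
  by [].
move=> t t01 /=; have qt := qpos t t01; have pt := p_gt0 t01.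
(* Eliminating [E] by the energy law leaves a rational identity in the values at [t], with the two
   logarithms as atoms. *)
have -> : E = (dp t ^+ 2 - sigma ^+ 4) / p t ^+ 2.
  by rewrite energy; field; rewrite gt_eqF.
by rewrite /a; field; rewrite !gt_eqF.
Qed.

Let prim_z (q v : R -> R) : primitive01 q v ->
  (forall t : R, t \in `[0, 1] -> 0 < q t) ->
  primitive01 (fun t => ln (q t) - ln (p t))
    (fun t => (q t)^-1 * v t - (p t)^-1 * dp t).
Proof.
move=> qv qpos.
have := primitive01D (primitive01_ln qv qpos)
  (primitive01Z (-1) (primitive01_ln prim_p p_gt0)).
by congr primitive01; apply/funext => t /=; rewrite mulN1r.
Qed.

Let cost_lty : (cost eps a < +oo)%E.
Proof.
rewrite costE; apply: integrable_lty => //.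
apply: (@integrable_continuousM R a a) => //.
by apply: continuous_compact_integrable => //; exact: segment_compact.
Qed.

(** Integrating [calibration] shows that four times the excess cost is the integral of a nonnegative
    [D]. If the excess vanishes, so does [D] almost everywhere; its square term then equates the
    logarithmic derivatives of [q] and [p], and equal initial values give [q = p]. *)
Lemma extremal_cost (q c : R -> R) : feasible p0 p1 sigma q c ->
  (cost eps a <= cost eps c)%E /\
  ((cost eps c <= cost eps a)%E ->
    (forall t : R, t \in `[0, 1] -> q t = p t) /\
    {ae mu, forall t : R, t \in `[0, 1] -> c t = a t}).
Proof.
move=> fqc; have [v qv cv] := feasible_density fqc.
have [mc _ qpos _ [q0 q1]] := fqc.
have aeF := ae_filter_ringOfSetsType mu.
pose C t := (v t - sigma ^+ 2) / (2 * q t).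
have mv : measurable_fun (`[0, 1] : set R) v by have /measurable_int/measurable_EFinP := qv.1.
have prim_qV := primitive01V qv (fun t t01 => lt0r_neq0 (qpos t t01)).
have mC : measurable_fun (`[0, 1] : set R) C.
  rewrite (_ : C = (fun t => (v t - sigma ^+ 2) * (2^-1 * (q t)^-1))); last first.
    by apply/funext => t; rewrite /C invfM.
  apply: measurable_funM; first exact: measurable_funB.
  apply: measurable_funM => //.
  by apply: subspace_continuous_measurable_fun => //; exact: primitive01_continuous prim_qV.
pose C2 t := C t ^+ 2; pose A2 t := a t ^+ 2.
have mC2 : measurable_fun (`[0, 1] : set R) C2 by exact: measurable_funX.
have iA2 : mu.-integrable `[0, 1] (EFin \o A2).
  apply: (@integrable_continuousM R a a) => //.
  by apply: continuous_compact_integrable => //; exact: segment_compact.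
have costA : cost eps a = (\int[mu]_(t in `[0, 1]) A2 t)%:E.
  by rewrite costE /Rintegral fineK//; exact: integrable_fin_num.
have costC : cost eps c = (\int[mu]_(t in `[0%R, 1%R]) (C2 t)%:E)%E.
  rewrite costE; apply: ge0_ae_eq_integral => //.
  - by apply/measurable_EFinP; exact: measurable_funX.
  - exact/measurable_EFinP.
  - by move=> t _; rewrite lee_fin sqr_ge0.
  - by move=> t _; rewrite lee_fin sqr_ge0.
  - by move: cv; apply: filterS => t cv t01; rewrite /C2 /C -cv.
(* Integrating the calibration identity requires a finite cost. A competitor of infinite cost is
   strictly worse, since [a] is continuous on [0, 1]. *)
have [iC2|niC2] := pselect (mu.-integrable `[0, 1] (EFin \o C2)); last first.
  have -> : cost eps c = +oo%E.
    apply/eqP; rewrite -leye_eq leNgt; apply/negP => ltoo; apply: niC2.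
    apply/integrableP; split; first exact/measurable_EFinP.
    rewrite costC in ltoo; apply: le_lt_trans ltoo.
    rewrite le_eqVlt; apply/orP; left; apply/eqP.
    by apply: eq_integral => t _ /=; rewrite ger0_norm// sqr_ge0.
  rewrite leey; split => //.
  by rewrite leye_eq => /eqP E0; move: cost_lty; rewrite E0 ltxx.
have {}costC : cost eps c = (\int[mu]_(t in `[0, 1]) C2 t)%:E.
  by rewrite costC /Rintegral fineK//; exact: integrable_fin_num.
have [h [ih h0 hE]] := calibration qv qpos q0 q1.
have iZ k u : mu.-integrable `[0, 1] (EFin \o u) ->
    mu.-integrable `[0, 1] (EFin \o (fun r => k * u r)).
  exact: (@integrableZl _ _ _ mu _ _ k (EFin \o u)).
pose D t := 4 * C2 t - 4 * A2 t - h t.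
have iCA : mu.-integrable `[0, 1] (EFin \o (fun t => 4 * C2 t - 4 * A2 t)).
  by apply: (@integrableB _ _ _ mu _ _ (EFin \o (fun t => 4 * C2 t))
    (EFin \o (fun t => 4 * A2 t))) => //; exact: iZ.
have iD : mu.-integrable `[0, 1] (EFin \o D).
  exact: (@integrableB _ _ _ mu _ _ (EFin \o (fun t => 4 * C2 t - 4 * A2 t)) (EFin \o h)).
have intD : \int[mu]_(t in `[0, 1]) D t =
    4 * (\int[mu]_(t in `[0, 1]) C2 t - \int[mu]_(t in `[0, 1]) A2 t).
  rewrite /D RintegralB// h0 subr0 RintegralB//; try exact: iZ.
  by rewrite !RintegralZl// mulrBr.
have DE (t : R) : t \in `[0, 1] -> D t =
    (v t / q t - dp t / p t) ^+ 2 +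
    sigma ^+ 4 * (q t ^- 2 - p t ^- 2 + 2 * (ln (q t) - ln (p t)) / p t ^+ 2).
  exact: hE.
have gap_ge0 (t : R) : t \in `[0, 1] ->
    0 <= sigma ^+ 4 * (q t ^- 2 - p t ^- 2 + 2 * (ln (q t) - ln (p t)) / p t ^+ 2).
  move=> t01; apply: mulr_ge0; first by rewrite exprn_even_ge0.
  by apply: convexity_gap_ge0; [exact: p_gt0|exact: qpos].
have D_ge0 (t : R) : t \in `[0, 1] -> 0 <= D t.
  by move=> t01; rewrite DE// addr_ge0 ?sqr_ge0 ?gap_ge0.
have intD_ge0 : 0 <= \int[mu]_(t in `[0, 1]) D t by exact: Rintegral_ge0.
split.
  by rewrite costA costC lee_fin -subr_ge0; move: intD_ge0; rewrite intD pmulr_rge0.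
rewrite costA costC lee_fin => CA.
have intD0 : \int[mu]_(t in `[0, 1]) D t = 0.
  apply/eqP; rewrite eq_le intD_ge0 andbT intD pmulr_rle0// subr_le0//.
have /(ae_eq_integral_abs mu) : (\int[mu]_(t in `[0%R, 1%R]) `|(D t)%:E| = 0)%E.
  transitivity (\int[mu]_(t in `[0%R, 1%R]) (D t)%:E)%E.
    by apply: eq_integral => t; rewrite inE/= => t01; rewrite ger0_norm// D_ge0.
  rewrite -[LHS]fineK; last exact: integrable_fin_num.
  by rewrite -/(Rintegral _ _ _) intD0.
move=> /(_ (measurable_itv _) (measurable_int _ iD)) D0.
have du0 : {ae mu, forall t : R, t \in `[0, 1] -> v t / q t = dp t / p t}.
  move: D0; apply: filterS => t Dt t01.
  have [] := Dt t01; rewrite DE// => /eqP.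
  rewrite paddr_eq0 ?sqr_ge0 ?gap_ge0// => /andP[].
  by rewrite sqrf_eq0 subr_eq0 => /eqP.
have qp (t : R) : t \in `[0, 1] -> q t = p t.
  move=> t01; have /andP[t0 t1] : 0 <= t <= 1 by rewrite in_itv in t01.
  rewrite -[LHS]lnK ?posrE ?qpos// -[RHS]lnK ?posrE ?p_gt0//; congr expR.
  apply/eqP; rewrite -subr_eq0.
  have pz := prim_z qv qpos; rewrite (pz.2 t t01) q0 p_0 subrr add0r.
  rewrite /Rintegral (ae_eq_integral (cst 0%E))//=.
  - by rewrite integral0.
  - exact: measurable_int (integrable01_itv true false (lexx 0) t1 pz.1).
  - move: du0; apply: filterS => s du s0t; rewrite /cst; congr EFin.
    rewrite mulrC du 1?mulrC ?subrr//.
    by move: s0t; rewrite /= !in_itv/= => /andP[-> st]; exact: le_trans t1.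
split => //; move: cv du0; apply: filterS2 => t cv du t01.
rewrite cv// /a -qp//; congr (_ / _); congr (_ - _).
have := du t01; rewrite qp// => /(congr1 ( *%R^~ (p t))).
by rewrite !divfK// gt_eqF// p_gt0.
Qed.

Lemma extremal_unique_solution : is_unique_solution p0 p1 sigma eps p a.
Proof.
split; first by split=> [|q c /extremal_cost[]//]; exact: extremal_feasible.
move=> q c [fqc /(_ p a extremal_feasible) le].
exact: (extremal_cost fqc).2.
Qed.

End extremal.
End verification.

(** * Fitting the parameters to the endpoints *)

Section boundary_values.
Context (R : realType).
Implicit Types p s t : R.

Lemma is_derive_affine_comp (f : R -> R) (k c t df : R) :
  is_derive (k * t + c) 1 f df -> is_derive t 1 (fun x => f (k * x + c)) (k * df).
Proof.
move=> fdf; have H : is_derive t 1 (fun x : R => k * x + c) k.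
  have -> : (fun x : R => k * x + c) = (k \*: id) + cst c by [].
  by apply: is_derive_eq; rewrite addr0 /GRing.scale/= mulr1.
have := @is_derive1_comp R f (fun x : R => k * x + c) t df k fdf H.
by rewrite mulrC.
Qed.

(** The value at 0 is a quadratic equation for [alpha], with positive root
    [(p0 * b + r b) / (2 * b)]. Substituting this root leaves one equation in [b] for the value at
    1, solved by the intermediate value theorem. *)
Lemma hyperbolic_boundary_increasing p0 p1 s : 0 < p0 -> 0 < s -> s < p1 - p0 ->
  exists alpha b : R, [/\ 0 < alpha, 0 < b,
    s ^+ 2 / (4 * alpha * b ^+ 2) = alpha - p0 &
    alpha * expR b - (alpha - p0) * expR (- b) = p1].
Proof.
move=> p00 s0 sp.
have p01 : p0 < p1 by rewrite -subr_gt0 (lt_trans s0).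
pose r b := Num.sqrt (p0 ^+ 2 * b ^+ 2 + s ^+ 2).
(* [g b] is [2 * b] times the excess over [p1] of the path at time 1. The factor makes [b = 0] a
   spurious root, so a sign change must be found among positive [b]. *)
pose g b := (p0 * b + r b) * (expR b - expR (- b))
            + 2 * b * p0 * expR (- b) - 2 * b * p1.
(* Since [e^b - e^(-b) <= 2 b e^b] for [b > 0], [g b] is at most [2 * b * (F b - p1)], and
   [F 0 = s + p0 < p1] makes this negative for small [b]. *)
pose F b := (p0 * b + r b) * expR b + p0 * expR (- b).
have id_cont : continuous (fun b : R => b) by move=> b; exact: cvg_id.
have expN_cont : continuous (fun b : R => expR (- b)).
  by move=> b; apply: continuous_comp; [exact: cvgN|exact: continuous_expR].
have r_cont : continuous r.
  move=> b; apply: continuous_comp; last exact: sqrt_continuous.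
  apply: cvgD; last exact: cvg_cst.
  by apply: cvgM; [exact: cvg_cst|apply: cvgM].
have pr_cont : continuous (fun b => p0 * b + r b).
  move=> b; apply: cvgD; last exact: r_cont.
  by apply: cvgM; [exact: cvg_cst|].
have F_cont : continuous F.
  move=> b; apply: cvgD; apply: cvgM; [exact: pr_cont|exact: continuous_expR|
    exact: cvg_cst|exact: expN_cont].
have b2_cont k : continuous (fun b : R => 2 * b * k).
  by move=> b; apply: cvgM; [apply: cvgM; [exact: cvg_cst|]|exact: cvg_cst].
have g_cont : continuous g.
  move=> b; apply: cvgB; last exact: b2_cont.
  apply: cvgD.
    apply: cvgM; first exact: pr_cont.
    by apply: cvgB; [exact: continuous_expR|exact: expN_cont].
  by apply: cvgM; [exact: b2_cont|exact: expN_cont].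
(* At this exponent [p0 * e^b] alone reaches [p1], and the remaining part of [g B] is nonnegative
   because [r B >= p0 * B]. *)
pose B := ln (p1 / p0).
have eB : expR B = p1 / p0 by rewrite lnK// posrE divr_gt0// (lt_trans p00).
have B0 : 0 < B by rewrite ln_gt0// ltr_pdivlMr// mul1r.
have rge b : 0 < b -> p0 * b <= r b.
  move=> b0; rewrite -[leLHS]ger0_norm; last by rewrite mulr_ge0// ltW.
  rewrite -sqrtr_sqr.
  by apply: ler_wsqrtr; rewrite exprMn lerDl sqr_ge0.
have gB : 0 <= g B.
  have -> : g B = (p0 * B + r B - 2 * p0 * B) * (expR B - expR (- B)) +
      2 * B * (p0 * expR B - p1) by rewrite /g; ring.
  have -> : p0 * expR B - p1 = 0 by rewrite eB; field; rewrite gt_eqF.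
  rewrite mulr0 addr0; apply: mulr_ge0; first by have := rge B B0; lra.
  by rewrite subr_ge0 ler_expR; lra.
have [b0 [b00 b0B Fb0]] : exists b0, [/\ 0 < b0, b0 < B & F b0 < p1].
  have F0 : F 0 < p1.
    rewrite /F /r mulr0 expr0n mulr0 !add0r oppr0 expR0 !mulr1 sqrtr_sqr gtr0_norm//.
    lra.
  have : \forall b \near (0 : R)^'+, [/\ 0 < b, b < B & F b < p1].
    near=> b; split; near: b; [exact: nbhs_right_gt|exact: nbhs_right_lt|].
    exact: (cvgr_lt (F 0) (cvg_at_right_filter (F_cont 0))).
  by move=> /filter_ex.
have gb0 : g b0 <= 0.
  have e2 : expR b0 - expR (- b0) <= 2 * b0 * expR b0.
    have := expR_ge1Dx (- b0 + - b0); rewrite expRD expRN => H.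
    have e0 := expR_gt0 b0.
    have := ler_wpM2l (ltW e0) H; rewrite mulrA divff ?gt_eqF// mul1r; lra.
  have pr0 : 0 <= p0 * b0 + r b0 by rewrite addr_ge0 ?sqrtr_ge0// mulr_ge0// ltW.
  have := ler_wpM2l pr0 e2.
  have : 2 * b0 * F b0 <= 2 * b0 * p1 by rewrite ler_wpM2l ?mulr_ge0// ltW.
  rewrite /g /F; lra.
have [|b] := @IVT R g b0 B 0 (ltW b0B) (continuous_subspaceT g_cont).
  by rewrite ge_min gb0 le_max gB orbT.
rewrite in_itv/= => /andP[b0b bB] gb.
have bpos : 0 < b by exact: lt_le_trans b0b.
have r2 : r b ^+ 2 = p0 ^+ 2 * b ^+ 2 + s ^+ 2.
  by rewrite /r sqr_sqrtr//; apply: addr_ge0; [apply: mulr_ge0|]; exact: sqr_ge0.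
have prpos : 0 < p0 * b + r b by rewrite ltr_pwDl ?mulr_gt0 ?sqrtr_ge0.
exists ((p0 * b + r b) / (2 * b)), b; split => //.
- by rewrite divr_gt0 ?mulr_gt0.
- have -> : s ^+ 2 = (r b - p0 * b) * (p0 * b + r b).
    have -> : s ^+ 2 = r b ^+ 2 - p0 ^+ 2 * b ^+ 2 by rewrite r2; ring.
    ring.
  by field; rewrite !gt_eqF.
- apply: (@mulfI _ (2 * b)); first by rewrite gt_eqF// mulr_gt0.
  apply/eqP; rewrite -subr_eq0 -gb /g; apply/eqP; field.
  by rewrite gt_eqF.
Unshelve. all: by end_near. Qed.

Lemma hyperbolic_boundary p0 p1 s : 0 < p0 -> 0 < p1 -> 0 < s ->
  s < `|p1 - p0| ->
  exists alpha b : R, [/\ alpha != 0, b != 0 &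
    let p t := alpha * expR (b * t) - s ^+ 2 / (4 * alpha * b ^+ 2) * expR (- (b * t)) in
    [/\ p 0 = p0, p 1 = p1 & forall t : R, t \in `[0, 1] -> 0 < p t]].
Proof.
move=> p00 p10 s0 sp.
(* The path starts at [q], and neither term lets it decrease: the growing exponential has a positive
   coefficient and the subtracted decaying one a nonnegative coefficient. *)
have pos q (alpha b t : R) : 0 < q -> 0 < alpha -> 0 < b -> 0 <= t ->
    0 <= alpha - q -> 0 < alpha * expR (b * t) - (alpha - q) * expR (- (b * t)).
  move=> q0 a0 b0 t0 aq; apply: lt_le_trans q0 _.
  have bt : 0 <= b * t by rewrite mulr_ge0// ltW.
  have := ler_wpM2l (ltW a0) (_ : 1 <= expR (b * t)).
  have := ler_wpM2l aq (_ : expR (- (b * t)) <= 1).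
  rewrite -{1 3}expR0 !ler_expR oppr_le0 => /(_ bt) + /(_ bt); lra.
have kge0 (alpha b : R) : 0 < alpha -> 0 <= s ^+ 2 / (4 * alpha * b ^+ 2).
  by move=> a0; rewrite divr_ge0 ?sqr_ge0// mulr_ge0 ?sqr_ge0// mulr_ge0// ltW.
have [le|le] := leP p0 p1.
  have sp' : s < p1 - p0 by rewrite -[ltRHS]ger0_norm// subr_ge0.
  have [alpha [b [a0 b0 ka H1]]] := hyperbolic_boundary_increasing p00 s0 sp'.
  exists alpha, b; rewrite !gt_eqF//; split=> //=; rewrite ka; split.
  - by rewrite mulr0 oppr0 expR0; ring.
  - by rewrite mulr1.
  - move=> t; rewrite in_itv/= => /andP[t0 _]; apply: pos => //.
    by rewrite -ka kge0.
have sp' : s < p0 - p1 by rewrite -[ltRHS]ger0_norm ?subr_ge0 ?ltW// distrC.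
have [alpha [b [a0 b0 ka H1]]] := hyperbolic_boundary_increasing p10 s0 sp'.
(* Time reversal: the increasing path from [p1] to [p0] is evaluated at [1 - t]. *)
exists (alpha * expR b), (- b).
have eb := expR_gt0 b.
have kE : s ^+ 2 / (4 * (alpha * expR b) * (- b) ^+ 2) = (alpha - p1) * expR (- b).
  by rewrite -ka expRN; field; rewrite !gt_eqF.
rewrite oppr_eq0 !gt_eqF ?mulr_gt0//; split=> //=; rewrite kE; split.
- by rewrite mulr0 oppr0 expR0 !mulr1.
- by rewrite mulr1 opprK !expRN; field; rewrite gt_eqF.
- move=> t; rewrite in_itv/= => /andP[t0 t1].
  rewrite -!mulrA -!expRD (_ : b + - b * t = b * (1 - t)); last ring.
  rewrite (_ : - b + - (- b * t) = - (b * (1 - t))); last ring.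
  by apply: pos; rewrite ?subr_ge0// -subr_ge0 -ka kge0.
Qed.

Lemma mul_cos_le_sin t : 0 < t -> t < pi / 2 -> t * cos t <= sin t.
Proof.
move=> t0 tpi.
have [x] := MVT t0 (fun x _ => is_derive_sin x)
  (continuous_subspaceT (@continuous_sin R)).
rewrite in_itv/= => /andP[x0 xt]; rewrite sin0 !subr0 => ->.
rewrite mulrC ler_pM2r// ltW// ltr_cos// in_itv/=; have := @pi_gt0 R => pi0; lra.
Qed.

(** A half-period shift, after a reflection when [t] is positive, brings the outer quarters of the
    period into [0, pi / 2] and changes the sign of [cos]. *)
Lemma cos_gt0_pihalf_inv t : - pi <= t <= pi -> 0 < cos t -> - (pi / 2) < t < pi / 2.
Proof.
move=> /andP[tpi pit] ct; have pi0 := @pi_gt0 R.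
apply/andP; split; rewrite ltNge; apply/negP => le.
  have : 0 <= cos (t + pi) by apply: cos_ge0_pihalf; apply/andP; split; lra.
  by rewrite cosDpi oppr_ge0 leNgt ct.
have : 0 <= cos (- t + pi) by apply: cos_ge0_pihalf; apply/andP; split; lra.
by rewrite cosDpi cosN oppr_ge0 leNgt ct.
Qed.

(** The unknowns are the half-width [h = omega / 2] and the mid-phase [m = theta + h]. The sum and
    difference of the endpoint equations give [cos m = S * h / cos h] and [sin m = - D * h / sin h],
    so that [h] is determined by [sin^2 + cos^2 = 1]. *)
Lemma trigonometric_boundary p0 p1 s : 0 < p0 -> 0 < p1 -> 0 < s ->
  `|p1 - p0| < s ->
  exists omega theta : R, [/\ 0 < omega < pi, - (pi / 2) < theta < pi / 2,
    omega + theta < pi / 2, s / omega * cos theta = p0 &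
    s / omega * cos (omega + theta) = p1].
Proof.
move=> p00 p10 s0 ps; have pi0 := @pi_gt0 R.
pose S := (p0 + p1) / s; pose D := (p1 - p0) / s.
have S0 : 0 < S by rewrite divr_gt0 ?addr_gt0.
have D1 : D ^+ 2 < 1.
  rewrite -real_normK ?num_real// expr_lt1// normrM normfV (gtr0_norm s0).
  by rewrite ltr_pdivrMr// mul1r.
(* The equation for [h] with denominators cleared, which adds the spurious root 0. *)
pose G h := D ^+ 2 * h ^+ 2 * cos h ^+ 2 + S ^+ 2 * h ^+ 2 * sin h ^+ 2
  - sin h ^+ 2 * cos h ^+ 2.
(* By [h * cos h <= sin h], [G h] is at most [sin h ^+ 2 * F h] on the first quarter period, and
   [F 0 = D^2 - 1 < 0]. *)
pose F h := D ^+ 2 + S ^+ 2 * h ^+ 2 - cos h ^+ 2.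
have sq_cont (f : R -> R) : continuous f -> continuous (fun h => f h ^+ 2).
  by move=> cf h; apply: cvgM; exact: cf.
have cos2 := sq_cont _ (@continuous_cos R).
have sin2 := sq_cont _ (@continuous_sin R).
have h2 (k : R) : continuous (fun h : R => k * h ^+ 2).
  by move=> h; apply: cvgM; [exact: cvg_cst|apply: sq_cont => x; exact: cvg_id].
have F_cont : continuous F.
  move=> h; apply: cvgB; last exact: cos2.
  by apply: cvgD; [exact: cvg_cst|exact: h2].
have G_cont : continuous G.
  move=> h; apply: cvgB; [apply: cvgD|]; apply: cvgM;
    by [exact: h2|exact: cos2|exact: sin2].
have [h0 [h00 h0pi Fh0]] : exists h0, [/\ 0 < h0, h0 < pi / 2 & F h0 < 0].
  have F0 : F 0 < 0 by rewrite /F cos0 expr0n mulr0 addr0 expr1n subr_lt0.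
  have : \forall h \near (0 : R)^'+, [/\ 0 < h, h < pi / 2 & F h < 0].
    near=> h; split; near: h; [exact: nbhs_right_gt|
      apply: nbhs_right_lt; by rewrite divr_gt0|].
    exact: (cvgr_lt (F 0) (cvg_at_right_filter (F_cont 0))).
  by move=> /filter_ex.
have Gpi : 0 < G (pi / 2).
  rewrite /G cos_pihalf sin_pihalf expr0n expr1n !mulr0 subr0 add0r mulr1.
  by apply: mulr_gt0; apply: exprn_gt0 => //; rewrite divr_gt0.
have Gh0 : G h0 <= 0.
  have ch0 : 0 <= cos h0 by apply: cos_ge0_pihalf; apply/andP; split; lra.
  have hc : (h0 * cos h0) ^+ 2 <= sin h0 ^+ 2.
    have := mul_cos_le_sin h00 h0pi; have := mulr_ge0 (ltW h00) ch0.
    by move=> ? ?; rewrite lerXn2r ?nnegrE//; lra.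
  have := ler_wpM2l (sqr_ge0 D) hc.
  have : sin h0 ^+ 2 * F h0 <= 0 by rewrite mulr_ge0_le0 ?sqr_ge0// ltW.
  rewrite /G /F exprMn; lra.
have [|h] := @IVT R G h0 (pi / 2) 0 (ltW h0pi) (continuous_subspaceT G_cont).
  by rewrite ge_min Gh0 le_max (ltW Gpi) orbT.
rewrite in_itv/= => /andP[h0h hpi] Gh.
have hpos : 0 < h by exact: lt_le_trans h0h.
have {}hpi : h < pi / 2.
  by rewrite lt_neqAle hpi andbT; apply/eqP => E; move: Gpi; rewrite -E Gh ltxx.
have ch : 0 < cos h by apply: cos_gt0_pihalf; apply/andP; split; lra.
have sh : 0 < sin h by apply: sin_gt0_pi; apply/andP; split; lra.
pose x := - D * h / sin h; pose y := S * h / cos h.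
have y0 : 0 < y by rewrite divr_gt0// mulr_gt0.
have xy : x ^+ 2 + y ^+ 2 = 1.
  apply/eqP; rewrite -subr_eq0.
  have -> : x ^+ 2 + y ^+ 2 - 1 = G h / (sin h ^+ 2 * cos h ^+ 2).
    by rewrite /x /y /G; field; rewrite !gt_eqF.
  by rewrite Gh mul0r.
have x1 : -1 <= x <= 1.
  rewrite -ler_norml -(@ler_pXn2r _ 2)// ?nnegrE// expr1n real_normK ?num_real//.
  by rewrite -xy lerDl sqr_ge0.
pose m := asin x.
have [mpi sm] := asin_def x1; rewrite -/m in mpi sm.
have cm : cos m = y.
  by rewrite cos_asin// -xy addrC addKr sqrtr_sqr gtr0_norm.
have ct0 : cos (m - h) = 2 * h * p0 / s.
  by rewrite cosB cm sm /x /y /S /D; field; rewrite !gt_eqF.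
have ct1 : cos (m + h) = 2 * h * p1 / s.
  by rewrite cosD cm sm /x /y /S /D; field; rewrite !gt_eqF.
(* Both end phases lie in [-pi, pi] and have positive cosine because [p0] and [p1] are positive,
   which confines them to the open half period around 0. *)
have /andP[t0 t0'] : - (pi / 2) < m - h < pi / 2.
  apply: cos_gt0_pihalf_inv; last by rewrite ct0 divr_gt0 ?mulr_gt0.
  by case/andP: mpi => ? ?; apply/andP; split; lra.
have /andP[t1 t1'] : - (pi / 2) < m + h < pi / 2.
  apply: cos_gt0_pihalf_inv; last by rewrite ct1 divr_gt0 ?mulr_gt0.
  by case/andP: mpi => ? ?; apply/andP; split; lra.
exists (2 * h), (m - h); split.
- by apply/andP; split; lra.
- by rewrite t0.
- lra.
- by rewrite ct0; field; rewrite !gt_eqF.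
- rewrite (_ : 2 * h + (m - h) = m + h); last ring.
  by rewrite ct1; field; rewrite !gt_eqF.
Unshelve. all: by end_near. Qed.

End boundary_values.

(** * The hyperbolic and trigonometric extremals *)

Lemma is_derive_comb (R : realType) (f g : R -> R) (x y t df dg : R) :
  is_derive t 1 f df -> is_derive t 1 g dg ->
  is_derive t 1 (fun z => x * f z - y * g z) (x * df - y * dg).
Proof. by move=> fdf gdg; exact: is_deriveB. Qed.

Lemma is_derive_scale (R : realType) (f : R -> R) (x t df : R) :
  is_derive t 1 f df -> is_derive t 1 (fun z => x * f z) (x * df).
Proof. by move=> fdf; exact: is_deriveZ. Qed.

Lemma is_derive_exp_scale (R : realType) (k t : R) :
  is_derive t 1 (fun x => expR (k * x)) (k * expR (k * t)).
Proof.
have -> : (fun x => expR (k * x)) = (fun x => expR (k * x + 0)).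
  by apply/funext => x; rewrite addr0.
apply: is_derive_eq (is_derive_affine_comp (is_derive_expR (k * t + 0))) _.
by rewrite addr0.
Qed.

Lemma is_derive_exp_scaleN (R : realType) (k t : R) :
  is_derive t 1 (fun x => expR (- (k * x))) (- k * expR (- (k * t))).
Proof.
have -> : (fun x => expR (- (k * x))) = (fun x => expR (- k * x)).
  by apply/funext => x; rewrite mulNr.
by rewrite -mulNr; exact: is_derive_exp_scale.
Qed.

Lemma hyperbolic_solution (R : realType) (p0 p1 sigma eps : R) :
  0 < p0 -> 0 < p1 -> 0 < sigma -> sigma ^+ 2 < `|p1 - p0| ->
  exists p a : R -> R,
    is_unique_solution p0 p1 sigma eps p a /\
    exists alpha b : R,
      [/\ alpha != 0, b != 0 &
        forall t : R, t \in `[0, 1] ->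
          p t = alpha * expR (b * t)
                - sigma ^+ 4 / (4 * alpha * b ^+ 2) * expR (- (b * t))].
Proof.
move=> p00 p10 sigma0 lt; have s0 : 0 < sigma ^+ 2 by rewrite exprn_gt0.
have [alpha [b [a0 b0]]] := hyperbolic_boundary p00 p10 s0 lt.
rewrite -exprM [(2 * 2)%N]/=; set k := sigma ^+ 4 / _.
set p := fun t => _ => -[p_0 p_1 pos].
pose dp t := alpha * b * expR (b * t) - k * - b * expR (- (b * t)).
(* The control is left open; [extremal_unique_solution] supplies it as
   [(dp t - sigma ^+ 2) / (2 * p t)]. *)
exists p; eexists; split; last by exists alpha, b.
apply: (@extremal_unique_solution R p0 p1 sigma eps (b ^+ 2) p dp) => //.
- move=> t; apply: is_derive_eq (is_derive_comb alpha k
    (is_derive_exp_scale b t) (is_derive_exp_scaleN b t)) _.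
  by rewrite /dp; ring.
- move=> t; apply: is_derive_eq (is_derive_comb (alpha * b) (k * - b)
    (is_derive_exp_scale b t) (is_derive_exp_scaleN b t)) _.
  by rewrite /p; ring.
(* Here [dp^2 - b^2 p^2] is the constant [4 * alpha * k * b^2], which the choice of [k] makes equal
   to [sigma^4]. *)
- move=> t; rewrite /p /dp expRN /k; field.
  by rewrite a0 b0 gt_eqF// expR_gt0.
Qed.

Lemma trigonometric_solution (R : realType) (p0 p1 sigma eps : R) :
  0 < p0 -> 0 < p1 -> 0 < sigma -> `|p1 - p0| < sigma ^+ 2 ->
  exists p a : R -> R,
    is_unique_solution p0 p1 sigma eps p a /\
    exists omega theta : R,
      [/\ 0 < omega < pi, - (pi / 2) < theta < pi / 2 &
        forall t : R, t \in `[0, 1] ->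
          p t = sigma ^+ 2 / omega * cos (omega * t + theta)].
Proof.
move=> p00 p10 sigma0 lt; have s0 : 0 < sigma ^+ 2 by rewrite exprn_gt0.
have [omega [theta [wpi tpi wtpi H0 H1]]] := trigonometric_boundary p00 p10 s0 lt.
have /andP[w0 _] := wpi; have /andP[th0 _] := tpi.
pose p t := sigma ^+ 2 / omega * cos (omega * t + theta).
pose dp t := - sigma ^+ 2 * sin (omega * t + theta).
exists p; eexists; split; last by exists omega, theta.
apply: (@extremal_unique_solution R p0 p1 sigma eps (- omega ^+ 2) p dp) => //.
- move=> t; apply: is_derive_eq (is_derive_scale (sigma ^+ 2 / omega)
    (is_derive_affine_comp (is_derive_cos (omega * t + theta)))) _.
  by rewrite /dp; field; rewrite gt_eqF.
- move=> t; apply: is_derive_eq (is_derive_scale (- sigma ^+ 2)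
    (is_derive_affine_comp (is_derive_sin (omega * t + theta)))) _.
  by rewrite /p; field; rewrite gt_eqF.
- move=> t; rewrite /p /dp exprMn sin2cos2; field.
  by rewrite gt_eqF.
(* The phase runs from [theta] to [omega + theta], and both lie strictly between [- pi / 2] and
   [pi / 2]. *)
- move=> t; rewrite in_itv/= => /andP[t0 t1]; rewrite mulr_gt0 ?divr_gt0//.
  have wt0 : 0 <= omega * t by rewrite mulr_ge0// ltW.
  have wt1 : omega * t <= omega by rewrite ger_pMr.
  by apply: cos_gt0_pihalf; apply/andP; split; lra.
- by rewrite /p mulr0 add0r.
- by rewrite /p mulr1.
Qed.

Unset Implicit Arguments.

Theorem proposition5 (R : realType) (p0 p1 sigma eps : R)
    (hp0 : 0 < p0) (hp1 : 0 < p1) (hsigma : 0 < sigma) (heps : 0 < eps) :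
  (sigma ^+ 2 < `|p1 - p0| ->
    exists p a : R -> R,
      is_unique_solution p0 p1 sigma eps p a /\
      exists alpha b : R,
        [/\ alpha != 0, b != 0 &
          forall t : R, t \in `[0, 1] ->
            p t = alpha * expR (b * t)
                  - sigma ^+ 4 / (4 * alpha * b ^+ 2) * expR (- (b * t))]) /\
  (`|p1 - p0| < sigma ^+ 2 ->
    exists p a : R -> R,
      is_unique_solution p0 p1 sigma eps p a /\
      exists omega theta : R,
        [/\ 0 < omega < pi, - (pi / 2) < theta < pi / 2 &
          forall t : R, t \in `[0, 1] ->
            p t = sigma ^+ 2 / omega * cos (omega * t + theta)]).
Proof.
split=> lt; first exact: hyperbolic_solution.
exact: trigonometric_solution.
Qed.
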